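(* There exists a minimal subshift $X$ such that: (1) $X$ has linear-growth complexity, i.e. there is a constant $C>0$ with $p_X(n)\le Cn$ for all $n\ge1$; (2) if $\boldsymbol{\sigma} = (\sigma_n\colon \mathcal{A}_{n+1}\to\mathcal{A}_n^+)_{n\geq 0}$ is an $\mathcal{S}$-adic sequence generating $X$ for which there is a constant $d\ge1$ such that (P1) $\#\big(\mathrm{root}\,\sigma_{[0,n)}(\mathcal{A}_n)\big) \leq d$ for every $n\ge0$, (P2) $|\sigma_{[0,n)}(a)| \leq d\cdot|\sigma_{[0,n)}(b)|$ for every $n\ge0$ and all $a,b\in\mathcal{A}_n$, (P3) $|\sigma_{n-1}(a)| \leq d$ for every $n\ge1$ and all $a\in\mathcal{A}_n$, then $\sup_{n\geq1}\#\mathcal{A}_n=+\infty$.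
   Context: An alphabet is a finite nonempty set $\mathcal{A}$; $\mathcal{A}^+$ is the set of nonempty finite words over $\mathcal{A}$, and $|w|$ is the length of a word $w$. The shift $S$ on $\mathcal{A}^{\mathbb{Z}}$ (product of discrete topologies) is $S((x_n)_n)=(x_{n+1})_n$. A subshift is a closed set $X\subseteq\mathcal{A}^{\mathbb{Z}}$ with $S(X)=X$; it is minimal if it is nonempty and contains no closed, $S$-invariant subset other than $\emptyset$ and $X$. $p_X(n)$ is the number of words of length $n$ that occur in at least one $x\in X$. A map $\tau\colon\mathcal{A}\to\mathcal{B}^+$ is extended by concatenation to $\mathcal{A}^+\to\mathcal{B}^+$. An $\mathcal{S}$-adic sequence is a sequence $\boldsymbol{\sigma}=(\sigma_n\colon\mathcal{A}_{n+1}\to\mathcal{A}_n^+)_{n\ge0}$ of such maps, where the $\mathcal{A}_n$ are alphabets. For $n\ge1$, $\sigma_{[0,n)}=\sigma_0\circ\sigma_1\circ\cdots\circ\sigma_{n-1}\colon\mathcal{A}_n\to\mathcal{A}_0^+$; $\sigma_{[0,0)}$ is the identity. The subshift generated by $\boldsymbol{\sigma}$ is $X_{\boldsymbol{\sigma}}\subseteq\mathcal{A}_0^{\mathbb{Z}}$, where $x\in X_{\boldsymbol{\sigma}}$ if and only if for every $\ell\geq0$ the word $x_{-\ell}\cdots x_{\ell}$ occurs in $\sigma_{[0,n)}(a)$ for some $n\ge1$ and $a\in\mathcal{A}_n$. $\boldsymbol{\sigma}$ generates $X$ if $X_{\boldsymbol{\sigma}}=X$. For a nonempty word $u$, $\mathrm{root}\,u$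 is the shortest prefix $v$ of $u$ such that $u=v^k$ for some $k\ge1$; for a set of words $\mathcal{W}$, $\mathrm{root}\,\mathcal{W}=\{\mathrm{root}\,w: w\in\mathcal{W}\}$. $\#$ denotes cardinality. *)

(* Defs.v *)
From mathcomp Require Import all_boot all_order all_algebra.
From mathcomp Require Import finmap.
From mathcomp Require Import boolp classical_sets reals constructive_ereal ereal.
From mathcomp Require Import topology.

Set Implicit Arguments.
Unset Strict Implicit.
Unset Printing Implicit Defensive.

Import Order.TTheory GRing.Theory Num.Theory.

Local Open Scope classical_set_scope.
Local Open Scope ring_scope.

Definition shift {A : Type} (x : int -> A) : int -> A := fun n => x (n + 1).

(* Closedness in the product over Z of copies of the discrete space A. *)
Definition closedZ (A : finType) (X : set (int -> A)) : Prop :=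
  closed (X : set {ptws int -> discrete_topology A}).

Definition subshift (A : finType) (X : set (int -> A)) : Prop :=
  closedZ X /\ shift @` X = X.

(* S-invariance of Y is S(Y) `<=` Y; asking for S(Y) = Y instead gives an
   equivalent notion of minimality, by compactness. *)
Definition minimal_subshift (A : finType) (X : set (int -> A)) : Prop :=
  [/\ subshift X, X !=set0 &
      forall Y : set (int -> A),
        closedZ Y -> shift @` Y `<=` Y -> Y `<=` X -> Y = set0 \/ Y = X].

(* The word x_i x_(i+1) ... x_(i+n-1). *)
Definition window (A : Type) (x : int -> A) (i : int) (n : nat) : seq A :=
  [seq x (i + k%:Z) | k <- iota 0 n].

Definition complexity (A : finType) (X : set (int -> A)) (n : nat) : nat :=
  #|[set w : n.-tuple A |
      `[< exists2 x, X x & exists i : int, window x i n = w >]]%SET|.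

(* The alphabets are [letters n]; [subst n] maps letters of the (n+1)-st one
   to nonempty words over the n-th one. *)
Record sadic := Sadic {
  letters : nat -> finType;
  subst : forall n, letters n.+1 -> seq (letters n);
  letters_gt0 : forall n, (0 < #|letters n|)%N;
  subst_neq0 : forall n (a : letters n.+1), subst a != [::]
}.

Definition extend (A B : Type) (t : A -> seq B) (w : seq A) : seq B :=
  flatten (map t w).

(* The composition subst 0 \o ... \o subst n.-1, written on letters. *)
Fixpoint subst_upto (s : sadic) (n : nat) : letters s n -> seq (letters s 0) :=
  match n with
  | 0 => fun a => [:: a]
  | m.+1 => fun a => extend (@subst_upto s m) (subst a)
  end.

Definition sadic_subshift (s : sadic) : set (int -> letters s 0) :=
  [set x | forall l : nat, exists n (a : letters s n),
    (1 <= n)%N /\ infix (window x (- l%:Z) l.*2.+1) (subst_upto a)].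
Arguments sadic_subshift : clear implicits.

(* Equality of a set of sequences over A with one over B, when A and B are
   seen as subsets of a common alphabet C: types being disjoint, this is how
   the two sets can be equal although A and B need not be the same alphabet
   (some letters may occur in no point). For A = B it holds if X = Y. *)
Definition eq_in_common_alphabet (A B : finType)
    (X : set (int -> A)) (Y : set (int -> B)) : Prop :=
  exists (C : finType) (f : A -> C) (g : B -> C),
    [/\ injective f, injective g &
        [set f \o x | x in X] = [set g \o y | y in Y]].

Definition generates (s : sadic) (A : finType) (X : set (int -> A)) : Prop :=
  eq_in_common_alphabet (sadic_subshift s) X.

Definition wpow (A : Type) (v : seq A) (k : nat) : seq A :=
  flatten (nseq k v).

(* The shortest prefix of u of which u is a power: [find] returns the least
   length m for which the prefix of length m qualifies. *)
Definition word_root (A : eqType) (u : seq A) : seq A :=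
  take (find (fun m => `[< exists k, (1 <= k)%N /\ u = wpow (take m u) k >])
             (iota 0 (size u).+1)) u.

Definition nb_roots (s : sadic) (n : nat) : nat :=
  #|` [fset word_root (subst_upto a) | a in letters s n]%fset|.

Section Conditions.
Context {R : realType}.

Definition linear_complexity (A : finType) (X : set (int -> A)) : Prop :=
  exists C : R, 0 < C /\
    forall n, (1 <= n)%N -> (complexity X n)%:R <= C * n%:R.

Definition P1 (s : sadic) (d : R) : Prop :=
  forall n, (nb_roots s n)%:R <= d.

Definition P2 (s : sadic) (d : R) : Prop :=
  forall n (a b : letters s n),
    (size (subst_upto a))%:R <= d * (size (subst_upto b))%:R.

Definition P3 (s : sadic) (d : R) : Prop :=
  forall n (a : letters s n.+1), (size (subst a))%:R <= d.

Definition sup_alphabets (s : sadic) : \bar R :=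
  ereal_sup [set (#|letters s n|%:R)%:E | n in [set n | (1 <= n)%N]].

End Conditions.

(* Main.v *)
Require Import Defs.
From mathcomp Require Import all_boot all_order all_algebra.
From mathcomp Require Import boolp classical_sets reals constructive_ereal ereal.
From mathcomp Require Import topology zify.

Set Implicit Arguments.
Unset Strict Implicit.
Unset Printing Implicit Defensive.

Local Open Scope nat_scope.

(** The subshift is built from two sequences of words over {0, 1}.  Starting from
    [u = 0] and [w = 1], each step replaces [w] by [w u^m w] and either keeps [u]
    or, to end a stage, replaces it by [u^m w u^m]; the exponents are such that
    [|w| <= m |u|], and they grow within a stage.  The points of the subshift are
    those all of whose windows occur in the words [w].

    Complexity is linear because, at each level, points are products of words
    [w u^e] with [e >= m].  A window no longer than [m |u|] thus meets at most one
    [w] and is a factor of [u^k w u^k] for a small [k], a word of length linear in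
    the length of the window ([tower_cover]).  Infinitely many changes of [u]
    force every long window to contain each given [w] ([tower_recurrent]), whence
    minimality.

    Within a stage, the runs [u^m] between two [w]s have many different exponents
    [m_0, ..., m_(r-1)], comparable to each other.  Suppose that an S-adic
    sequence generates the subshift, with at most [K] letters in its alphabets and
    with balanced lengths that grow by bounded factors.  Some level then cuts the
    points into blocks whose common order of magnitude is that of these runs,
    but which are shorter ([level_of_size]).  Each run is a sum of boundedly many
    pieces: the blocks inside the run and its two ends.  The ends are determined
    by two consecutive blocks, because the place where the period of [u] breaks
    can be read off them ([run_pieces]).  So there are at most [K + 2 K^2]
    different pieces.  If [r] is larger than this number, then there are more
    combinations of the [m_j] with coefficients below a large [q] than sums of
    pieces to represent them ([count_values]).  It remains to choose the [m_j]
    so that these combinations are distinct: [m_j = 3^j M + q^j] with [M >= q^r]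
    does it ([exponent_inj]), since the values modulo [M] are then numbers written
    in base [q].  The stages of the construction go through all [K], so no bound
    on the alphabets is possible ([no_bounded_sadic]). *)

(** * Words and their factors *)

Lemma size_wpow (T : Type) (v : seq T) k : size (wpow v k) = k * size v.
Proof. by elim: k => // k IHk; rewrite /wpow /= size_cat -/(wpow v k) IHk. Qed.

Lemma wpowD (T : Type) (v : seq T) a b : wpow v (a + b) = wpow v a ++ wpow v b.
Proof. by rewrite /wpow nseqD flatten_cat. Qed.

Lemma wpowS (T : Type) (v : seq T) k : wpow v k.+1 = v ++ wpow v k.
Proof. by []. Qed.

Lemma wpowSr (T : Type) (v : seq T) k : wpow v k.+1 = wpow v k ++ v.
Proof. by rewrite -addn1 wpowD /wpow /= cats0. Qed.

Lemma map_wpow (T S : Type) (f : T -> S) (v : seq T) k :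
  map f (wpow v k) = wpow (map f v) k.
Proof. by rewrite /wpow map_flatten map_nseq. Qed.

Lemma cat_split_le (T : Type) (a b p q : seq T) :
  a ++ b = p ++ q -> size a <= size p -> exists2 p', p = a ++ p' & b = p' ++ q.
Proof.
elim: a p => [|x a IHa] [|y p] //= E le; first by exists [::].
  by exists (y :: p).
by case: E => -> /IHa /(_ le)[p' -> ->]; exists p'.
Qed.

(** A factor no longer than [b] cannot stick out of [b] on both sides. *)
Lemma infix_overlap (T : eqType) (x a b c : seq T) :
  infix x (a ++ b ++ c) -> size x <= size b ->
  infix x (a ++ b) \/ infix x (b ++ c).
Proof.
move=> /infixP[p [q E]] le_xb; case: (leqP (size a) (size p)) => [le_ap|lt_pa].
  by right; have [p' _ ->] := cat_split_le E le_ap; apply: infix_infix.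
left; rewrite catA in E; rewrite [in RHS]catA in E; symmetry in E.
have [|q' -> _] := cat_split_le E; first by rewrite !size_cat; lia.
by rewrite -catA infix_infix.
Qed.

Lemma map_infix (T S : eqType) (f : T -> S) (s t : seq T) :
  infix s t -> infix (map f s) (map f t).
Proof. by move=> /infixP[p [q ->]]; rewrite !map_cat infix_infix. Qed.

(** A factor of given length is determined by its starting position. *)
Lemma card_factors (A : finType) n (s : seq A) (P : n.-tuple A -> bool) :
  0 < n -> (forall w, P w -> infix w s) -> #|[set w | P w]%SET| <= size s.
Proof.
move=> n_gt0 sub.
have [a _|A0] := pickP (mem A); last first.
  rewrite (eq_card (B := pred0)) ?card0 // => w.
  by have := A0 (tnth w (Ordinal n_gt0)); rewrite inE.
pose f (i : 'I_(size s)) : n.-tuple A := [tuple nth a s (i + j) | j < n].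
apply: (@leq_trans #|f @: 'I_(size s)|%SET); last first.
  by apply: leq_trans (leq_imset_card _ _) _; rewrite card_ord.
apply/subset_leq_card/fintype.subsetP => w; rewrite inE => /sub /infixP[p [q E]].
have lt_ps : size p < size s.
  by rewrite E !size_cat size_tuple -[X in X < _]addn0 ltn_add2l ltn_addr.
apply/imsetP; exists (Ordinal lt_ps) => //; apply: eq_from_tnth => j.
rewrite tnth_mktuple /= E nth_cat ltnNge leq_addr /= addKn nth_cat size_tuple.
by rewrite ltn_ord (tnth_nth a).
Qed.

(** The factor starts inside some word of the list, or at its beginning, and is
    long enough to reach the end of the next one. *)
Lemma infix_flatten_mem (T : eqType) (x : seq T) (vs : seq (seq T)) B :
  infix x (flatten vs) -> {in vs, forall v, size v <= B} -> 0 < B ->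
  2 * B <= size x -> exists2 v, v \in vs & infix v x.
Proof.
move=> /infixP[p [q E]] + B_gt0 le_Bx; elim: vs p E => [|v vs IHvs] p /= E leB.
  by move: (congr1 size E); rewrite !size_cat /=; lia.
have le_v : size v <= B by apply: leB; rewrite mem_head.
have {}leB : {in vs, forall v, size v <= B}.
  by move=> t t_vs; apply: leB; rewrite inE t_vs orbT.
case: (leqP (size v) (size p)) => [le_vp|lt_pv].
  have [p' _ E'] := cat_split_le E le_vp.
  by have [t t_vs tx] := IHvs _ E' leB; exists t => //; rewrite inE t_vs orbT.
symmetry in E; have [v1 v_def E1] := cat_split_le E (ltnW lt_pv).
have le_v1 : size v1 <= B by move: (congr1 size v_def); rewrite size_cat; lia.
have [|x2 x_def E2] := cat_split_le (esym E1) _; first by lia.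
have le_x2 : B <= size x2 by move: (congr1 size x_def); rewrite size_cat; lia.
case: vs E2 {IHvs E E1} leB => [|v2 vs] /= E2 leB.
  by move: (congr1 size E2); rewrite size_cat /=; lia.
have := leB v2; rewrite mem_head => /(_ isT) le_v2.
have [|x3 x2_def _] := cat_split_le E2 _; first by lia.
by exists v2; rewrite ?inE ?eqxx ?orbT // x_def x2_def infix_infix.
Qed.

(** * Towers of words *)

(** The condition [tm_big] makes the length of [tw i.+1] at most three times that
    of the run it contains, and [tu_change] makes the subshift minimal. *)
Record tower := Tower {
  tu : nat -> seq bool;
  tw : nat -> seq bool;
  tm : nat -> nat;
  tu0 : tu 0 = [:: false];
  tw0 : tw 0 = [:: true];
  tw_step : forall i, tw i.+1 = tw i ++ wpow (tu i) (tm i) ++ tw i;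
  tu_step : forall i, (tu i.+1 = tu i /\ tm i <= tm i.+1) \/
    tu i.+1 = wpow (tu i) (tm i) ++ tw i ++ wpow (tu i) (tm i);
  tm_big : forall i, size (tw i) <= tm i * size (tu i);
  tu_change : forall i, exists2 j, i <= j &
    tu j.+1 = wpow (tu j) (tm j) ++ tw j ++ wpow (tu j) (tm j)
}.

Section Tower.
Variable t : tower.
Implicit Types (x y : seq bool) (i j k n : nat).

Lemma tw_size i : i < size (tw t i).
Proof.
by elim: i => [|i IHi]; [rewrite tw0 | rewrite tw_step !size_cat; lia].
Qed.

Lemma tm_gt0 i : 0 < tm t i.
Proof. by have := tm_big t i; have := tw_size i; case: (tm t i) => //; lia. Qed.

Lemma tu_gt0 i : 0 < size (tu t i).
Proof.
have := tm_big t i; have := tw_size i.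
by case: (size (tu t i)); rewrite // muln0; lia.
Qed.

Lemma head_tw i : exists y, tw t i = true :: y.
Proof.
elim: i => [|i [y E]]; first by exists [::]; rewrite tw0.
by rewrite tw_step E; exists (y ++ wpow (tu t i) (tm t i) ++ true :: y).
Qed.

Lemma last_tw i : exists y, tw t i = rcons y true.
Proof.
elim: i => [|i [y E]]; first by exists [::]; rewrite tw0.
by rewrite tw_step E -!rcons_cat; eexists.
Qed.

Lemma head_tu i : exists y, tu t i = false :: y.
Proof.
elim: i => [|i [y E]]; first by exists [::]; rewrite tu0.
case: (tu_step t i) => [[-> _]|->]; first by exists y.
by have := tm_gt0 i; case: (tm t i) => // m _; rewrite wpowS E; eexists.
Qed.

Lemma last_tu i : exists y, tu t i = rcons y false.
Proof.
elim: i => [|i [y E]]; first by exists [::]; rewrite tu0.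
case: (tu_step t i) => [[-> _]|->]; first by exists y.
have := tm_gt0 i; case: (tm t i) => // m _; rewrite wpowSr E.
by rewrite -!rcons_cat; eexists.
Qed.

Lemma tw_infix i j : i <= j -> infix (tw t i) (tw t j).
Proof.
move=> /subnK <-; elim: (j - i) => [|k IHk]; first exact: infix_refl.
by rewrite addSn tw_step infix_catr.
Qed.

(** The shape, seen from level [i], of all longer words of the tower; the lower
    bound on the exponents is what keeps the complexity small. *)
Definition spaced i y := exists2 es : seq nat, all (leq (tm t i)) es &
  y = flatten [seq tw t i ++ wpow (tu t i) e | e <- es].

Lemma spaced_nil i : spaced i [::].
Proof. by exists [::]. Qed.

Lemma spaced_cons i e y :
  tm t i <= e -> spaced i y -> spaced i (tw t i ++ wpow (tu t i) e ++ y).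
Proof. by move=> le_e [es le_es ->]; exists (e :: es); rewrite /= ?le_e -?catA. Qed.

Lemma spaced_cat i x y : spaced i x -> spaced i y -> spaced i (x ++ y).
Proof.
by move=> [es le_es ->] [fs le_fs ->]; exists (es ++ fs);
  rewrite ?all_cat ?le_es // map_cat flatten_cat.
Qed.

(** Two consecutive copies of the new filling word create a run of exponent
    [2 * tm t i]; the induction therefore needs the free exponent [a]. *)
Lemma spaced_change i a e : tm t i <= a ->
  spaced i (tw t i ++ wpow (tu t i) a ++ tw t i ++ wpow (tu t i) (tm t i) ++
    wpow (wpow (tu t i) (tm t i) ++ tw t i ++ wpow (tu t i) (tm t i)) e).
Proof.
elim: e a => [|e IHe] a le_a; apply: spaced_cons => //.
  by apply: spaced_cons => //; apply: spaced_nil.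
rewrite wpowS -!catA (catA (wpow _ _) (wpow _ _)) -wpowD.
by apply: IHe; rewrite leq_addr.
Qed.

Lemma spaced_down i y : spaced i.+1 y -> spaced i y.
Proof.
move=> [es + ->]; elim: es => [|e es IHes] /=; first by move=> _; apply: spaced_nil.
move=> /andP[le_e /IHes]; apply: spaced_cat; rewrite tw_step.
case: (tu_step t i) => [[-> le_m]|->]; rewrite -!catA.
  apply: spaced_cons => //; rewrite -[wpow _ e]cats0.
  by apply: spaced_cons; [apply: leq_trans le_e | apply: spaced_nil].
case: e le_e => [|e _]; first by rewrite leqNgt tm_gt0.
by apply: spaced_cons => //; rewrite wpowS -!catA; apply: spaced_change.
Qed.

Lemma spaced_le i j y : i <= j -> spaced j y -> spaced i y.
Proof.
move=> /subnK <-; elim: (j - i) => //= k IHk.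
by rewrite addSn => /spaced_down.
Qed.

Lemma tw_spaced i j : i <= j -> exists2 y, spaced i y & infix (tw t j) y.
Proof.
move=> le_ij; exists (tw t j ++ wpow (tu t j) (tm t j)); last exact: prefix_infix.
by apply: spaced_le le_ij _; rewrite -[wpow _ _]cats0; apply: spaced_cons (spaced_nil _).
Qed.

(** ** Complexity *)

Lemma infix_wpow_le x i a b : a <= b -> infix x (wpow (tu t i) a) ->
  infix x (wpow (tu t i) b).
Proof. by move=> /subnK <-; rewrite wpowD; apply: infix_catl. Qed.

(** A factor of a power of [tu t i] can be moved by multiples of the period, so a
    short one already occurs in a small power. *)
Lemma infix_wpow_short x i e k : size x <= k * size (tu t i) ->
  infix x (wpow (tu t i) e) -> infix x (wpow (tu t i) k.+1).
Proof.
move=> le_x; elim: e => [|e IHe]; first exact: infix_wpow_le.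
case: (leqP e k) => [le_ek|lt_ke]; first exact: infix_wpow_le.
rewrite wpowS -[in wpow _ e](subnKC (ltnW lt_ke)) wpowD.
case/infix_overlap; rewrite ?size_wpow // -?wpowD.
by rewrite subnKC 1?ltnW.
Qed.

Lemma infix_wpow_cat x i e k y : size x <= k * size (tu t i) ->
  infix x (wpow (tu t i) e ++ y) -> infix x (wpow (tu t i) k.+1 ++ y).
Proof.
move=> le_x; case: (leqP e k) => [le_ek|lt_ke] xy.
  by rewrite -[k.+1](subnK (leqW le_ek)) wpowD -catA; apply: infix_catl.
move: xy; rewrite -(subnK (ltnW lt_ke)) wpowD -catA.
case/infix_overlap; rewrite ?size_wpow // => xy; last first.
  by rewrite wpowS -catA; apply: infix_catl.
by apply: infix_catr; rewrite -wpowD in xy; apply: infix_wpow_short xy.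
Qed.

Lemma infix_cat_wpow x i e k y : size x <= k * size (tu t i) ->
  infix x (y ++ wpow (tu t i) e) -> infix x (y ++ wpow (tu t i) k.+1).
Proof.
move=> le_x; case: (leqP e k) => [le_ek|lt_ke] xy.
  by rewrite -[k.+1](subnKC (leqW le_ek)) wpowD catA; apply: infix_catr.
move: xy; rewrite -(subnKC (ltnW lt_ke)) wpowD.
case/infix_overlap; rewrite ?size_wpow // => xy.
  by rewrite wpowSr catA; apply: infix_catr.
by apply: infix_catl; rewrite -wpowD in xy; apply: infix_wpow_short xy.
Qed.

(** A window that is shorter than every run of [tu t i] meets at most one
    [tw t i], and the runs around it can be cut down to the size of the window. *)
Lemma infix_spaced x y i k : spaced i y ->
  size x <= tm t i * size (tu t i) -> size x <= k * size (tu t i) -> infix x y ->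
  infix x (wpow (tu t i) k.+1 ++ tw t i ++ wpow (tu t i) k.+1).
Proof.
move=> [es le_es ->] le_m le_k xy.
have {xy}: infix x (wpow (tu t i) k.+1 ++
    flatten [seq tw t i ++ wpow (tu t i) e | e <- es]).
  exact: infix_catl.
elim: es le_es => [|e es IHes] /=; first by rewrite cats0 => _; apply: infix_catr.
move=> /andP[le_e le_es]; rewrite -(catA (tw t i)) catA => /infix_overlap.
rewrite size_wpow.
have le_x : size x <= e * size (tu t i) by apply: leq_trans le_m (leq_mul _ _).
case=> // xy; first by rewrite catA; apply: infix_cat_wpow xy.
by apply: IHes => //; apply: infix_wpow_cat xy.
Qed.

Lemma tower_size_step i :
  size (tw t i.+1) <= 3 * (tm t i * size (tu t i)) /\
  size (tu t i.+1) <= 3 * (tm t i * size (tu t i)).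
Proof.
have := tm_big t i; rewrite tw_step !size_cat size_wpow.
case: (tu_step t i) => [[-> _]|->]; rewrite ?size_cat ?size_wpow; last by lia.
by have := leq_mul (tm_gt0 i) (leqnn (size (tu t i))); lia.
Qed.

(** The level [i] is the first one whose runs are at least as long as the
    windows; the runs of level [i.-1] are then shorter than [n], which bounds the
    words of level [i] by [3 * n].  At level 0 both words are single letters. *)
Lemma tower_cover n : 0 < n -> exists2 y, size y <= 17 * n &
  forall x j, size x = n -> infix x (tw t j) -> infix x y.
Proof.
move=> n_gt0; have ex_i : exists i, n <= tm t i * size (tu t i).
  by exists n; apply: leq_trans (tm_big t n); apply/ltnW/tw_size.
case: (ex_minnP ex_i) => i le_n min_i; set p := size (tu t i) in le_n *.
have p_gt0 : 0 < p by apply: tu_gt0.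
have [le_p le_w] : p <= 3 * n /\ size (tw t i) <= 3 * n.
  case: i @p p_gt0 min_i {le_n} => [|i] p p_gt0 min_i.
    by rewrite /p tu0 tw0 /=; lia.
  have lt_n : tm t i * size (tu t i) < n.
    by rewrite ltnNge; apply/negP => /min_i; rewrite ltnn.
  by have [] := tower_size_step i; rewrite /p; lia.
have [k le_k ge_k] : exists2 k, n <= k * p & k * p <= n + p.
  exists (n %/ p).+1; first exact/ltnW/ltn_ceil.
  by rewrite mulSn addnC leq_add2r leq_divM.
exists (wpow (tu t i) k.+1 ++ tw t i ++ wpow (tu t i) k.+1).
  (* At most [2 * (n + 2 * (3 * n)) + 3 * n]. *)
  by rewrite (size_cat (wpow _ _)) (size_cat (tw t i)) !size_wpow -/p; lia.
move=> x j sz_x xj.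
have [y y_sp y_w] := tw_spaced (leq_maxl i j).
apply: (infix_spaced y_sp); rewrite ?sz_x //.
by apply: infix_trans y_w; apply: infix_trans xj (tw_infix (leq_maxr i j)).
Qed.

(** ** Recurrence *)

(** After a change of filling word, both words of the next level contain
    [tw t i], and everything is a concatenation of these two. *)
Lemma tower_recurrent i : exists R, forall x j,
  infix x (tw t j) -> R <= size x -> infix (tw t i) x.
Proof.
have [l le_il Eu] := tu_change t i.
pose B := size (tu t l.+1) + size (tw t l.+1); exists (2 * B) => x j xj le_x.
have [y [es _ ->] y_w] := tw_spaced (leq_maxl l.+1 j).
have {y_w xj} : infix x (flatten [seq tw t l.+1 ++ wpow (tu t l.+1) e | e <- es]).
  by apply: infix_trans y_w; apply: infix_trans xj (tw_infix (leq_maxr _ j)).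
have -> : flatten [seq tw t l.+1 ++ wpow (tu t l.+1) e | e <- es] =
  flatten (flatten [seq tw t l.+1 :: nseq e (tu t l.+1) | e <- es]).
  by elim: es => //= e es ->; rewrite flatten_cat -catA.
have mem_uw v : v \in flatten [seq tw t l.+1 :: nseq e (tu t l.+1) | e <- es] ->
  v = tw t l.+1 \/ v = tu t l.+1.
  move=> /flattenP[s /mapP[e _ ->]]; rewrite inE => /orP[/eqP->|]; first by left.
  by rewrite mem_nseq => /andP[_ /eqP->]; right.
case/infix_flatten_mem/(_ _ _ le_x).
- by move=> v /mem_uw[] ->; rewrite /B ?leq_addl ?leq_addr.
- by rewrite /B; have := tu_gt0 l.+1; lia.
move=> v /mem_uw v_uw; apply: infix_trans; apply: infix_trans (tw_infix le_il) _.
case: v_uw => ->; first exact: tw_infix.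
by rewrite Eu infix_infix.
Qed.

End Tower.

(** * The subshift of a tower *)

Import Order.TTheory GRing.Theory Num.Theory.
Local Open Scope classical_set_scope.
Local Open Scope ring_scope.

Section Windows.
Variable A : Type.
Implicit Types x y : int -> A.

Lemma size_window x i n : size (window x i n) = n.
Proof. by rewrite size_map size_iota. Qed.

Lemma nth_window a x i n k : (k < n)%N -> nth a (window x i n) k = x (i + k%:Z).
Proof. by move=> lt_kn; rewrite (nth_map 0%N) ?size_iota // nth_iota. Qed.

Lemma window_cat x i m n :
  window x i (m + n) = window x i m ++ window x (i + m%:Z) n.
Proof.
rewrite /window iotaD map_cat add0n -[in iota m n](addn0 m) iotaDl -map_comp.
by congr (_ ++ _); apply: eq_map => k /=; rewrite PoszD addrA.
Qed.

Lemma window_shift x i n k :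
  window (iter k shift x) i n = window x (i + k%:Z) n.
Proof.
apply: eq_map => j; elim: k i => [|k IHk] i; rewrite ?addr0 // iterS /shift.
by rewrite -addrA [j%:Z + 1]addrC addrA IHk; congr x; lia.
Qed.

Lemma eq_window x y i n : (forall k : int, i <= k < i + n%:Z -> x k = y k) ->
  window x i n = window y i n.
Proof. by move=> xy; apply/eq_in_map => k; rewrite mem_iota => ?; apply: xy; lia. Qed.

Lemma window_inj x y i n : window x i n = window y i n ->
  forall k : int, i <= k < i + n%:Z -> x k = y k.
Proof.
move=> xy k le_k; have -> : k = i + `|k - i|%N%:Z by lia.
rewrite -[LHS](@nth_window (x 0) _ _ n) ?xy ?nth_window //; lia.
Qed.
End Windows.

Lemma window_comp (A B : Type) (h : A -> B) (x : int -> A) i n :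
  window (h \o x) i n = map h (window x i n).
Proof. by rewrite /window -map_comp. Qed.

Lemma window_infix (A : eqType) (x : int -> A) (i j : int) m n :
  i <= j -> j + n%:Z <= i + m%:Z -> infix (window x j n) (window x i m).
Proof.
move=> le_ij le_n.
have -> : m = (absz (j - i)%R + (n + absz (i + m%:Z - (j + n%:Z))%R))%N by lia.
rewrite 2!window_cat; have -> : i + `|j - i|%N%:Z = j by lia.
exact: infix_infix.
Qed.

Lemma infix_windowP (A : eqType) (s : seq A) (x : int -> A) (i : int) n :
  infix s (window x i n) -> exists j, [/\ i <= j, j + (size s)%:Z <= i + n%:Z &
    window x j (size s) = s].
Proof.
move=> /infixP[p [q E]]; have := congr1 size E; rewrite size_window !size_cat => sz.
exists (i + (size p)%:Z); split; [lia | lia |].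
move: E; rewrite sz 2!window_cat.
move=> /eqP; rewrite eqseq_cat ?size_window // => /andP[_].
by rewrite eqseq_cat ?size_window // => /andP[/eqP].
Qed.

(** Agreement with [x] on a window is a neighbourhood of [x]; conversely, points
    that agree with [x] on larger and larger windows converge to [x] pointwise. *)
Lemma closedZP (A : finType) (X : set (int -> A)) : closedZ X <->
  forall x, (forall l : nat, exists2 y, X y &
    window y (- l%:Z) l.*2.+1 = window x (- l%:Z) l.*2.+1) -> X x.
Proof.
split=> [clX x X_x|clX]; last first.
  move=> x clx; apply: clX => l.
  pose V : set (int -> A) :=
    [set y | forall k : int,
      k \in [seq k%:Z - l%:Z | k <- iota 0 l.*2.+1] -> y k = x k].
  have /clx [y [Xy Vy]] : nbhs (x : {ptws int -> discrete_topology A}) V.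
    have FF : Filter (nbhs (x : {ptws int -> discrete_topology A})).
      exact: nbhs_filter.
    rewrite /V; elim: [seq _ | _ <- _] => [|k s IHs].
      by apply: (@filterS _ _ FF) filterT => y _ k; rewrite in_nil.
    have : nbhs (x : {ptws int -> discrete_topology A})
        [set y : {ptws int -> discrete_topology A} | y k = x k].
      have := @proj_continuous _ (fun _ : int => discrete_topology A) k x.
      move=> /(_ [set x k]); apply; rewrite nbhs_principalE.
      by apply/principal_filterP.
    apply: (@filterS2 _ _ FF) IHs => y ys yk j; rewrite inE => /orP[/eqP->//|]; exact: ys.
  exists y => //; apply: eq_window => k le_k; apply: Vy.
  apply/mapP; exists (absz (k + l%:Z)); last by lia.
  by rewrite mem_iota; lia.
have /choice[y Xy] : forall l : nat, exists y, X y /\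
    window y (- l%:Z) l.*2.+1 = window x (- l%:Z) l.*2.+1.
  by move=> l; have [y Xy E] := X_x l; exists y.
have cvg_y : y @ \oo --> (x : {ptws int -> discrete_topology A}).
  apply/(@pointwise_cvgP (discrete_topology int) (discrete_topology A)) => k.
  apply: cvg_near_cst; exists (absz k) => // l /= le_kl.
  have [_ /window_inj E] := Xy l; apply: E; lia.
apply: (closed_cvg _ clX _ _ cvg_y).
by apply: nearW => l; case: (Xy l).
Qed.

(** The origin is placed at the beginning of the word [f 0], which starts in [f l]
    at the position [c l], the total length of the words [a j] for [j < l]. *)
Lemma nested_limit (A : eqType) (f a b : nat -> seq A) : f 0%N != [::] ->
  (forall l, f l.+1 = a l ++ f l ++ b l) ->
  (forall l, a l != [::]) -> (forall l, b l != [::]) ->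
  exists x : int -> A, forall l, infix (window x (- l%:Z) l.*2.+1) (f l).
Proof.
move=> f0 fS a_n0 b_n0.
have [z _] : exists z : A, true by case: (f 0%N) f0 => // z; exists z.
have [c c0 cS] : exists2 c : nat -> nat, c 0%N = 0%N &
    forall l, c l.+1 = (size (a l) + c l)%N.
  exists (fun l => \sum_(j < l) size (a j))%N; first by rewrite big_ord0.
  by move=> l; rewrite big_ord_recr addnC.
have a_gt0 l : (0 < size (a l))%N by case: (a l) (a_n0 l).
have b_gt0 l : (0 < size (b l))%N by case: (b l) (b_n0 l).
have le_lc l : (l <= c l)%N.
  by elim: l => // l IHl; rewrite cS; have := a_gt0 l; lia.
have lt_cf l : (c l + l < size (f l))%N.
  elim: l => [|l IHl]; first by rewrite c0; case: (f 0%N) f0.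
  by rewrite cS fS !size_cat; have := b_gt0 l; lia.
have stable l m k : (l <= m)%N -> (k < size (f l))%N -> 
    nth z (f m) (k + c m - c l) = nth z (f l) k.
  move=> /subnK <-; elim: (m - l)%N => [|d IHd] lt_k; first by rewrite addnK.
  have le_c : (c l <= c (d + l))%N.
    by elim: (d) => // e; rewrite addSn cS => /leq_trans-> //; rewrite leq_addl.
  have lt_kd : (k + c (d + l) - c l < size (f (d + l)))%N.
    elim: (d) => [|e]; first by rewrite addnK.
    by rewrite addSn cS fS !size_cat; lia.
  rewrite addSn fS cS nth_cat ifF; last by lia.
  by rewrite nth_cat ifT -?IHd //; [congr nth; lia | lia].
exists (fun k => nth z (f `|k|%N) (absz ((c `|k|%N)%:Z + k))) => l.
apply/infixP; exists (take (c l - l) (f l)), (drop (c l + l.+1) (f l)).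
have := lt_cf l; have := le_lc l => le_c lt_c.
apply: (@eq_from_nth _ z) => [|k lt_k].
  by rewrite !size_cat size_window size_drop size_take; case: ltnP; lia.
rewrite nth_cat size_takel; last by lia.
case: ltnP => [lt_kc|le_kc]; first by rewrite nth_take.
rewrite nth_cat size_window; case: ltnP => [lt_kl|le_kl]; last first.
  by rewrite nth_drop; congr nth; lia.
rewrite nth_window //; set j : int := - _ + _.
have le_j : (`|j| <= l)%N by lia.
have := le_lc `|j|%N; have := lt_cf `|j|%N => lt_j le_jc.
have := stable _ _ (absz ((c `|j|%N)%:Z + j)) le_j.
move=> <-; last by lia.
by congr nth; lia.
Qed.

Section TowerShift.
Variable t : tower.

Definition tower_shift : set (int -> bool) :=
  [set x | forall l : nat, exists j, infix (window x (- l%:Z) l.*2.+1) (tw t j)].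

Lemma tower_shift_window x i n : tower_shift x -> exists j, infix (window x i n) (tw t j).
Proof.
move=> Xx; have [j xj] := Xx (absz i + n)%N; exists j.
by apply: infix_trans xj; apply: window_infix; lia.
Qed.

Lemma tower_shiftP x : (forall i n, exists j, infix (window x i n) (tw t j)) -> tower_shift x.
Proof. by move=> xP l. Qed.

Lemma shift_tower_shift : shift @` tower_shift = tower_shift.
Proof.
rewrite eqEsubset; split=> [_ [x Xx <-]|x Xx].
  apply: tower_shiftP => i n; rewrite (@window_shift _ x i n 1%N).
  exact: tower_shift_window (i + 1) n Xx.
exists (fun k => x (k - 1)); last by apply/funext => k; rewrite /shift addrK.
apply: tower_shiftP => i n; have [j xj] := tower_shift_window (i - 1) n Xx.
exists j; suff -> : window (fun k => x (k - 1)) i n = window x (i - 1) n by [].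
by apply: eq_map => k; congr x; lia.
Qed.

Lemma closed_tower_shift : closedZ tower_shift.
Proof.
by apply/closedZP => x xX l; have [y /(_ l)[j yj] <-] := xX l; exists j.
Qed.

Lemma tower_shift_nonempty : tower_shift !=set0.
Proof.
(* Two steps of the tower extend a word on both sides; one step does not. *)
have wS j : tw t j.+2 = (tw t j ++ wpow (tu t j) (tm t j)) ++ tw t j ++
    (wpow (tu t j.+1) (tm t j.+1) ++ tw t j.+1).
  by rewrite [LHS]tw_step {1}(tw_step t j) -!catA.
have w_n0 j s : tw t j ++ s != [::] by have [y ->] := head_tw t j.
have [||||x Xx] := @nested_limit _ (fun l => tw t l.*2)
  (fun l => tw t l.*2 ++ wpow (tu t l.*2) (tm t l.*2))
  (fun l => wpow (tu t l.*2.+1) (tm t l.*2.+1) ++ tw t l.*2.+1).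
- by rewrite tw0.
- by move=> l; rewrite doubleS wS.
- by move=> l; apply: w_n0.
- move=> l; have [y ->] := head_tw t l.*2.+1.
  by rewrite -size_eq0 size_cat addn_eq0 andbF.
by exists x => l; exists l.*2.
Qed.

(** The position can be taken arbitrarily far to the right: the sets considered in
    the definition of minimality need only be invariant under forward shifts. *)
Lemma tower_shift_visits x i j : tower_shift x ->
  exists2 k : int, i <= k & window x k (size (tw t j)) = tw t j.
Proof.
move=> Xx; have [R recR] := tower_recurrent t j.
have [l xl] := tower_shift_window i R Xx.
have /infix_windowP[k [le_ik _ xk]] := recR _ _ xl (eq_leq (esym (size_window _ _ _))).
by exists k.
Qed.

Lemma tower_shift_minimal : minimal_subshift tower_shift.
Proof.
split; first by split; [exact: closed_tower_shift | exact: shift_tower_shift].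
  exact: tower_shift_nonempty.
move=> Y clY shY YX; have [->|/set0P[y Yy]] := eqVneq Y set0; first by left.
right; rewrite eqEsubset; split=> // x Xx.
have {}Yy k : Y (iter k shift y).
  by elim: k => // k IHk; apply: shY; exists (iter k shift y).
move/closedZP: clY; apply=> l; have [j xj] := Xx l.
have [k k_ge0 yk] := tower_shift_visits 0 j (YX _ (Yy 0%N)).
move: xj; rewrite -yk => /infix_windowP[i [le_ki _]]; rewrite size_window => yi.
exists (iter (absz (i + l%:Z)) shift y); first exact: Yy.
by rewrite window_shift -yi; congr window; lia.
Qed.

Lemma tower_shift_linear (R : realType) : @linear_complexity R _ tower_shift.
Proof.
exists 17%:R; split; first by rewrite ltr0n.
move=> n n_gt0; rewrite -natrM ler_nat.
have [y sz_y cov] := tower_cover t n_gt0; apply: leq_trans sz_y.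
apply: card_factors => // w /asboolP[x Xx [i xi]].
have [j] := tower_shift_window i n Xx; rewrite xi; apply: cov.
by rewrite size_tuple.
Qed.
End TowerShift.

(** * Runs inside a concatenation of long blocks *)

Local Open Scope nat_scope.

Lemma find_iota (P : pred nat) n k : k < n -> P k ->
  (forall j, j < k -> ~~ P j) -> find P (iota 0 n) = k.
Proof.
move=> lt_kn Pk notP; have Pn : has P (iota 0 n).
  by apply/hasP; exists k; rewrite // mem_iota.
have lt_fn : find P (iota 0 n) < n by move: Pn; rewrite has_find size_iota.
case: (ltngtP (find P (iota 0 n)) k) => // [/notP|lt_kf].
  by have := nth_find 0 Pn; rewrite nth_iota // add0n => ->.
by have := before_find 0 lt_kf; rewrite nth_iota // add0n Pk.
Qed.

Lemma nth_wpow_period (T : Type) (z : T) (u : seq T) m i :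
  i + size u < m * size u -> nth z (wpow u m) (i + size u) = nth z (wpow u m) i.
Proof.
case: m => [|m] lt_i; first by rewrite mul0n in lt_i.
rewrite {1}wpowS wpowSr nth_cat ifF; last by lia.
rewrite addnK nth_cat size_wpow ifT //.
by rewrite mulSn addnC ltn_add2l in lt_i.
Qed.

Lemma flatten_locate (B T : Type) (blk : B -> seq T) bs i :
  i < size (flatten (map blk bs)) -> exists bs1 b bs2,
  [/\ bs = bs1 ++ b :: bs2, size (flatten (map blk bs1)) <= i &
      i < size (flatten (map blk bs1)) + size (blk b)].
Proof.
elim: bs i => //= b bs IHbs i; rewrite size_cat => lt_i.
case: (ltnP i (size (blk b))) => [lt_ib|le_bi]; first by exists [::], b, bs.
have [|bs1 [b1 [bs2 [-> le_i lt_i1]]]] := IHbs (i - size (blk b)); first by lia.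
by exists (b :: bs1), b1, bs2; rewrite /= size_cat; split => //; lia.
Qed.

Section Runs.
Variables (B : finType) (T : eqType) (blk : B -> seq T) (u : seq T) (z : T).
Local Notation p := (size u).

(** Where a run begins or ends inside a block, the period [p] fails, which can be
    seen on this block and its neighbour in the run.  The part of the run in that
    block is hence found by looking for the first failure, starting from the
    boundary between the two blocks. *)
Definition left_part (b : B * B) :=
  let s := blk b.1 ++ blk b.2 in let n := size (blk b.1) in
  find (fun i => nth z s (n.-1 - i + p) != nth z s (n.-1 - i)) (iota 0 n).

Definition right_part (b : B * B) :=
  let s := blk b.1 ++ blk b.2 in let n := size (blk b.1) in
  find (fun i => nth z s (n + i) != nth z s (n + i - p)) (iota 0 (size (blk b.2))).

Definition piece : finType := (B + (B * B + B * B))%type.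

Definition piece_size (x : piece) := match x with
  | inl b => size (blk b)
  | inr (inl bb) => left_part bb
  | inr (inr bb) => right_part bb
  end.

Hypotheses (L D : nat).
Hypothesis blk_ge : forall b, L <= size (blk b).
Hypothesis blk_le : forall b, size (blk b) <= D * L.
Hypotheses (p_gt0 : 0 < p) (le_pL : p <= L).
Hypotheses (head_u : head z u != z) (last_u : last z u != z).

Lemma size_blocks bs :
  size (flatten (map blk bs)) = \sum_(b <- bs) size (blk b) /\
  size bs * L <= size (flatten (map blk bs)).
Proof.
elim: bs => [|b bs [IH1 IH2]] /=; first by rewrite big_nil.
by rewrite size_cat big_cons IH1; split => //; have := blk_ge b; lia.
Qed.

(** The pieces are the blocks inside the run and the two ends of the run.  The run
    is longer than two blocks, so that at least one block lies inside it, and this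
    block is long enough to show the failure of the period at either end. *)
Lemma run_pieces m bs : 2 * D * L <= m * p ->
  infix (z :: wpow u m ++ [:: z]) (flatten (map blk bs)) ->
  exists2 xs : seq piece, m * p = \sum_(x <- xs) piece_size x &
    size xs * L <= m * p + 2 * L.
Proof.
move=> long /infixP[P [Q E]]; set s := flatten _ in E.
have L_gt0 : 0 < L by apply: leq_trans le_pL.
pose a := (size P).+1; pose e := a + m * p.
have nth_run i : i < m * p -> nth z s (a + i) = nth z (wpow u m) i.
  move=> lt_i; rewrite E nth_cat ifF; last by rewrite /a; lia.
  rewrite /a addSnnS addKn /= nth_cat.
  by rewrite size_cat size_wpow ltn_addr // nth_cat size_wpow lt_i.
have nth_a : nth z s a.-1 = z by rewrite E nth_cat ltnn subnn.
have nth_e : nth z s e = z.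
  rewrite E nth_cat ifF; last by rewrite /e /a; lia.
  rewrite /e /a addSn -addnS addKn /= nth_cat size_cat size_wpow addn1 leqnn.
  by rewrite nth_cat size_wpow ltnn subnn.
have lt_es : e < size s.
  by rewrite E !size_cat /= !size_cat size_wpow /= /e /a; lia.
have period i : a <= i -> i + p < e -> nth z s (i + p) = nth z s i.
  move=> le_ai lt_ie; have -> : i = a + (i - a) by lia.
  rewrite -addnA !nth_run; [|by rewrite /e in lt_ie; lia..].
  by apply: nth_wpow_period; rewrite /e in lt_ie; lia.
(* The block [b] contains the letter that precedes the run; [eb], found below,
   contains the one that follows it. *)
have [bs1 [b [bs2 [Ebs le_S1 lt_S1]]]] : exists bs1 b bs2,
    [/\ bs = bs1 ++ b :: bs2, size (flatten (map blk bs1)) <= a.-1 &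
      a.-1 < size (flatten (map blk bs1)) + size (blk b)].
  by apply: flatten_locate; move: lt_es; rewrite -/s /e /a; lia.
set S1 := size (flatten (map blk bs1)) in le_S1 lt_S1.
have D_gt0 : 0 < D by have := blk_le b; have := blk_ge b; case: (D) => //; lia.
have m_gt0 : 0 < m.
  by case: m long {nth_run lt_es nth_e period e E} => //; rewrite leqNgt !muln_gt0 D_gt0 L_gt0.
have mism_l : nth z s (a.-1 + p) != nth z s a.-1.
  rewrite nth_a; have -> : a.-1 + p = a + p.-1 by rewrite /a; lia.
  rewrite nth_run; last by rewrite (leq_trans _ (leq_pmull p m_gt0)) // ltn_predL.
  by case: (m) m_gt0 => // m' _; rewrite wpowS nth_cat ltn_predL p_gt0 nth_last.
have mism_r : nth z s e != nth z s (e - p).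
  rewrite nth_e; case: (m) m_gt0 @e nth_run {mism_l lt_es nth_e period} => // m' _ e nth_run.
  have -> : e - p = a + m' * p by rewrite /e mulSn; lia.
  rewrite nth_run; last by rewrite mulSn; lia.
  by rewrite wpowSr nth_cat size_wpow ltnn subnn nth0 eq_sym.
have sz2 := blk_le b; have szb := blk_ge b.
have Es : s = flatten (map blk bs1) ++ blk b ++ flatten (map blk bs2).
  by rewrite /s Ebs map_cat flatten_cat.
have sz_s : size s = S1 + (size (blk b) + size (flatten (map blk bs2))).
  by rewrite Es !size_cat.
have le_e : S1 + 2 * D * L < e by rewrite /e; lia.
have [bs3 [eb [bs4 [Ebs2 le_S2 lt_S2]]]] : exists bs3 eb bs4,
    [/\ bs2 = bs3 ++ eb :: bs4, size (flatten (map blk bs3)) <= e - (S1 + size (blk b)) &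
      e - (S1 + size (blk b)) < size (flatten (map blk bs3)) + size (blk eb)].
  by apply: flatten_locate; lia.
set S2 := size (flatten (map blk bs3)) in le_S2 lt_S2.
have szeb := blk_le eb; have szeb' := blk_ge eb.
have [b' [bs5 Eb5]] : exists b' bs5, bs3 = b' :: bs5.
  case: bs3 @S2 {Ebs2} le_S2 lt_S2 => [|b' bs5] /= *; last by exists b', bs5.
  by nia.
have [e' [bs6 Eb6]] : exists e' bs6, bs3 = rcons bs6 e'.
  rewrite Eb5; case/lastP: (bs5) => [|bs6 e']; first by exists b', [::].
  by exists e', (b' :: bs6); rewrite rcons_cons.
have szb' := blk_ge b'; have sze' := blk_ge e'.
have S2b : size (blk b') <= S2.
  by rewrite /S2 Eb5 /= size_cat leq_addr.
have S2e : size (flatten (map blk bs6)) + size (blk e') = S2.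
  by rewrite /S2 Eb6 map_rcons flatten_rcons size_cat.
have nth_l i : i < size (blk b) + size (blk b') ->
    nth z s (S1 + i) = nth z (blk b ++ blk b') i.
  move=> lt_i; rewrite Es nth_cat ifF -/S1 ?addKn; last by lia.
  by rewrite Ebs2 Eb5 /= catA nth_cat size_cat lt_i.
have nth_r i : i < size (blk e') + size (blk eb) ->
    nth z s (S1 + size (blk b) + size (flatten (map blk bs6)) + i) =
    nth z (blk e' ++ blk eb) i.
  have -> : s = (flatten (map blk bs1) ++ blk b ++ flatten (map blk bs6)) ++
      (blk e' ++ blk eb) ++ flatten (map blk bs4).
    by rewrite Es Ebs2 Eb6 map_cat map_rcons flatten_cat flatten_rcons /= -!catA.
  move=> lt_i; rewrite nth_cat !size_cat -/S1 addnA ltnNge leq_addr /= addKn.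
  by rewrite nth_cat size_cat lt_i.
have left_b : left_part (b, b') = S1 + size (blk b) - a.
  apply: find_iota => /= [||i lt_i].
  - by rewrite /a; lia.
  - rewrite -!nth_l; [|by rewrite /a; lia..].
    have -> : S1 + ((size (blk b)).-1 - (S1 + size (blk b) - a)) = a.-1 by lia.
    have -> : S1 + ((size (blk b)).-1 - (S1 + size (blk b) - a) + p) = a.-1 + p by lia.
    exact: mism_l.
  - by rewrite negbK -!nth_l ?addnA ?period //; lia.
have right_b : right_part (e', eb) = e - (S1 + size (blk b)) - S2.
  apply: find_iota => /= [||i lt_i].
  - by lia.
  - rewrite -!nth_r; [|by lia..].
    set j1 := _ + _; set j2 := _ + _.
    have [-> ->] : j1 = e /\ j2 = e - p by rewrite /j1 /j2; lia.
    exact: mism_r.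
  - rewrite negbK -!nth_r; [|by lia..]; set j1 := _ + _; set j2 := _ + _.
    have -> : j1 = j2 + p by rewrite /j1 /j2; lia.
    by rewrite period //; rewrite /j2; lia.
have [sumS2 le_bs3] := size_blocks bs3.
exists (inr (inl (b, b')) :: inr (inr (e', eb)) :: map inl bs3).
  rewrite !big_cons big_map /= left_b right_b -sumS2 -/S2.
  by rewrite /e in le_S2 lt_S2 le_e *; lia.
rewrite /= size_map -/S2 in le_bs3 *.
by rewrite /e in le_S2 lt_S2 *; lia.
Qed.
End Runs.

(** * Sums that take many values need many generators *)

Local Close Scope classical_set_scope.

(** A combination of the [v j] is determined by the number of times that it uses
    each element of [I]. *)
Lemma count_values (I : finType) (wt : I -> nat) r q Q
    (xs : 'I_r -> seq I) (v : 'I_r -> nat) :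
  (forall j, size (xs j) <= Q) ->
  (forall j, v j = \sum_(x <- xs j) wt x) ->
  (forall f g : {ffun 'I_r -> 'I_q},
     \sum_j f j * v j = \sum_j g j * v j -> f = g) ->
  q ^ r <= (r * q * Q).+1 ^ #|I|.
Proof.
move=> le_Q v_def v_inj.
have sum_count s : \sum_(x <- s) wt x = \sum_i count_mem i s * wt i.
  elim: s => [|x s IHs]; first by rewrite big_nil big1.
  rewrite big_cons IHs [in RHS](eq_bigr (fun i => (x == i) * wt i + count_mem i s * wt i)).
    rewrite big_split /=; congr (_ + _); rewrite (bigD1 x) //= eqxx mul1n.
    by rewrite big1 ?addn0 // => i /negPf; rewrite eq_sym => ->.
  by move=> i _; rewrite /= mulnDl.
pose coef (f : {ffun 'I_r -> 'I_q}) i := \sum_j f j * count_mem i (xs j).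
have sum_coef (f : {ffun 'I_r -> 'I_q}) : \sum_j f j * v j = \sum_i coef f i * wt i.
  rewrite [RHS](eq_bigr (fun i => \sum_j f j * (count_mem i (xs j) * wt i))).
    rewrite exchange_big; apply: eq_bigr => j _ /=.
    by rewrite v_def sum_count big_distrr.
  by move=> i _; rewrite big_distrl; apply: eq_bigr => j _; rewrite mulnA.
have coef_lt (f : {ffun 'I_r -> 'I_q}) i : coef f i < (r * q * Q).+1.
  rewrite ltnS -mulnA -[r in r * _]card_ord -sum_nat_const; apply: leq_sum => j _.
  by apply: leq_mul; [apply/ltnW | apply: leq_trans (count_size _ _) (le_Q j)].
pose F (f : {ffun 'I_r -> 'I_q}) : {ffun I -> 'I_(r * q * Q).+1} :=
  [ffun i => Ordinal (coef_lt f i)].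
have /leq_card : injective F.
  move=> f g /ffunP E; apply: v_inj; rewrite !sum_coef; apply: eq_bigr => i _.
  by have := congr1 val (E i); rewrite !ffunE /= => ->.
by rewrite !card_ffun !card_ord.
Qed.

Lemma digits_lt q r (f : nat -> nat) : (forall j, f j < q) ->
  \sum_(j < r) f j * q ^ j < q ^ r.
Proof.
move=> lt_fq; elim: r => [|r IHr]; first by rewrite big_ord0.
rewrite big_ord_recr /= expnS.
by apply: leq_trans (leq_mul (lt_fq r) (leqnn (q ^ r))); rewrite mulSn ltn_add2r.
Qed.

Lemma digits_inj q r (f g : nat -> nat) :
  (forall j, f j < q) -> (forall j, g j < q) ->
  \sum_(j < r) f j * q ^ j = \sum_(j < r) g j * q ^ j ->
  forall j, j < r -> f j = g j.
Proof.
move=> lt_f lt_g; elim: r => // r IHr; rewrite !big_ord_recr /= => E.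
have ltf := digits_lt r lt_f; have ltg := digits_lt r lt_g.
have Er : f r = g r.
  have q_gt0 : 0 < q ^ r by apply: leq_ltn_trans ltf.
  have := congr1 (divn^~ (q ^ r)) E.
  by rewrite /= !(addnC (\sum_(_ < _) _)) !divnMDl // !divn_small // !addn0.
move: E; rewrite Er => /addIn /IHr {}IHr j.
by rewrite ltnS leq_eqVlt => /orP[/eqP->|/IHr].
Qed.

(** The exponents used in the construction: [3 ^ j * M] makes them grow while
    staying comparable to each other, and, as [q ^ r <= M], the perturbation
    [q ^ j] makes all their combinations with coefficients below [q] distinct. *)
Definition exponent q M j := 3 ^ j * M + q ^ j.

Lemma exponent_inj q r M (f g : {ffun 'I_r -> 'I_q}) : q ^ r <= M ->
  \sum_j f j * exponent q M j = \sum_j g j * exponent q M j -> f = g.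
Proof.
case: q f g => [|q] f g le_M E.
  by apply/ffunP => j; case: (f j).
pose ext (f : {ffun 'I_r -> 'I_q.+1}) k := oapp (fun j => nat_of_ord (f j)) 0 (insub k).
have ext_lt h k : ext h k < q.+1 by rewrite /ext; case: insub => //= j.
have extE h (j : 'I_r) : ext h j = h j by rewrite /ext valK.
have split_sum (h : {ffun 'I_r -> 'I_q.+1}) : \sum_j h j * exponent q.+1 M j =
    (\sum_j h j * 3 ^ j) * M + \sum_(j < r) ext h j * q.+1 ^ j.
  rewrite big_distrl -big_split; apply: eq_bigr => j _ /=.
  by rewrite extE mulnDr mulnA.
have lt_M h : \sum_(j < r) ext h j * q.+1 ^ j < M.
  by apply: leq_trans le_M; apply: digits_lt.
have := congr1 (modn^~ M) E; rewrite /= !split_sum !modnMDl !modn_small //.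
move=> /digits_inj Eext; apply/ffunP => j; apply: val_inj.
by rewrite /= -!extE Eext.
Qed.

(** * Levels of an S-adic sequence *)

Section Levels.
Variables (s : sadic) (d : nat).
Hypothesis balanced : forall n (a b : letters s n),
  size (subst_upto a) <= d * size (subst_upto b).
Hypothesis bounded : forall n (a : letters s n.+1), size (subst a) <= d.

Lemma size_extend_le (A B : Type) (f : A -> seq B) w m :
  (forall a, size (f a) <= m) -> size (extend f w) <= size w * m.
Proof.
by move=> le_m; elim: w => //= a w IHw; rewrite /extend /= size_cat mulSn leq_add.
Qed.

Lemma subst_upto_blocks n N (a : letters s N) : n <= N ->
  exists bs : seq (letters s n), subst_upto a = flatten (map (@subst_upto s n) bs).
Proof.
move=> /subnK E; move: a; rewrite -E; elim: (N - n) => [|k IHk] a.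
  by exists [:: a]; rewrite /= cats0.
rewrite -[_.+1 + n]/(k + n).+1 /= in a *.
rewrite /extend; elim: (subst a) => [|b w [bs Ew]]; first by exists [::].
have [bs' Eb] := IHk b.
by exists (bs' ++ bs); rewrite map_cat flatten_cat -Ew -Eb.
Qed.

(** Lengths are balanced within each level and grow by bounded factors from one
    level to the next, so some level has all its words of length about [L]. *)
Lemma level_of_size L : 1 < L ->
  (forall m, exists n (a : letters s n), m <= size (subst_upto a)) ->
  exists n, [/\ 1 <= n,
    forall a : letters s n, L <= size (subst_upto a) <= d * d * L &
    forall N (a : letters s N), d * L < size (subst_upto a) ->
      exists bs : seq (letters s n), subst_upto a = flatten (map (@subst_upto s n) bs)].
Proof.
move=> L_gt1 unb.
have ex_n : exists n, `[< forall a : letters s n, L <= size (subst_upto a) >].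
  have [n [a le_a]] := unb (d * L); exists n; apply/asboolP => b.
  have d_gt0 : 0 < d.
    have [m [c c_gt0]] := unb 1; have := leq_trans c_gt0 (balanced c c).
    by rewrite muln_gt0 => /andP[].
  by rewrite -(leq_pmul2l d_gt0) (leq_trans le_a).
case: (ex_minnP ex_n) => n /asboolP ge_n min_n; exists n.
have below m (a : letters s m) : m < n -> size (subst_upto a) <= d * L.
  move=> lt_mn; have : ~ forall a : letters s m, L <= size (subst_upto a).
    by move/asboolP/min_n; rewrite leqNgt lt_mn.
  move=> /existsNP[b /negP]; rewrite -ltnNge => /ltnW lt_b.
  by apply: leq_trans (balanced a b) _; rewrite leq_mul2l lt_b orbT.
split.
- case: n ge_n {min_n below} => // ge_0.
  by have /card_gt0P[a _] := letters_gt0 s 0; have := ge_0 a; rewrite leqNgt L_gt1.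
- move=> a; rewrite ge_n /=; case: n a ge_n min_n below => [|n] a _ _ below.
    have := balanced a a; rewrite /= muln1 => d_gt0.
    by rewrite !muln_gt0 d_gt0 (ltnW L_gt1).
  rewrite -mulnA; apply: (@leq_trans (size (subst a) * (d * L))).
    by apply: size_extend_le => b; apply: below.
  by rewrite leq_mul2r bounded orbT.
- move=> N a lt_a; apply: subst_upto_blocks; rewrite leqNgt; apply/negP => lt_Nn.
  by have := below _ a lt_Nn; rewrite leqNgt lt_a.
Qed.

Lemma sadic_window x (i : int) n : sadic_subshift s x ->
  exists N (a : letters s N), infix (window x i n) (subst_upto a).
Proof.
move=> Xx; have [N [a [_ xa]]] := Xx (absz i + n)%N; exists N, a.
by apply: infix_trans xa; apply: window_infix; lia.
Qed.

End Levels.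

(** * The exponents of the construction *)

(** For alphabets with at most [K] letters and constants at most [K.+1], the number
    [size_ratio] bounds the ratio between the largest and the smallest blocks of a
    level, [nb_pieces] the number of different pieces, and [max_pieces] the
    number of pieces in a run. *)
Section StageSizes.
Variable K : nat.

Definition size_ratio := K.+1 * K.+1.
Definition nb_pieces := K + (K * K + K * K).
Definition stage_length := nb_pieces.+1.
Definition max_pieces := 2 * size_ratio * (3 ^ stage_length).+1 + 2.
Definition radix := (2 * stage_length * max_pieces) ^ nb_pieces + 3.

Lemma radix_gt2 : 2 < radix. Proof. by rewrite /radix addn3. Qed.

(** There are more combinations with coefficients below the radix than ways to use
    [k] pieces; this is where the stage must be longer than [nb_pieces]. *)
Lemma radix_big k : k <= nb_pieces ->
  (stage_length * radix * max_pieces).+1 ^ k < radix ^ stage_length.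
Proof.
move=> le_k; pose c := 2 * stage_length * max_pieces.
have c_lt : c ^ nb_pieces < radix by rewrite /radix -/c -[X in X < _]addn0 ltn_add2l.
have pos : 0 < stage_length * radix * max_pieces.
  by rewrite !muln_gt0 /radix /max_pieces addn3 addn2.
apply: (leq_ltn_trans (leq_pexp2l (ltn0Sn _) le_k)).
apply: (@leq_ltn_trans ((c * radix) ^ nb_pieces)).
  case: (posnP nb_pieces) => [->|gt0]; first by rewrite !expn0.
  by rewrite leq_exp2r // /c; move: pos; lia.
rewrite expnMn /stage_length expnS ltn_mul2r c_lt andbT expn_gt0.
by rewrite (ltn_trans _ radix_gt2).
Qed.

End StageSizes.

Lemma exponent_step q M j : 2 < q -> 3 * exponent q M j <= exponent q M j.+1.
Proof.
move=> q_gt2; rewrite /exponent mulnDr mulnA -expnS leq_add2l expnS.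
by rewrite leq_mul2r q_gt2 orbT.
Qed.

Lemma exponent_ge q M j : M <= exponent q M j.
Proof. by apply: leq_trans (leq_addr _ _); rewrite leq_pmull // expn_gt0. Qed.

Lemma exponent_le q r c M j : 0 < q -> 0 < c -> j <= r -> q ^ r <= M ->
  exponent q (c * M) j <= c * (3 ^ r).+1 * M.
Proof.
move=> q_gt0 c_gt0 le_jr le_M; rewrite /exponent mulnAC mulnS addnC leq_add //.
  apply: leq_trans (leq_pmull M c_gt0); apply: leq_trans le_M.
  by rewrite leq_pexp2l.
by rewrite mulnC leq_mul // leq_pexp2l.
Qed.

(** The words [u] and [w] of the construction are [fill] and [core]. The stage
    number is the bound that the stage is meant to defeat. *)
Record state := State {
  stage : nat; phase : nat; fill : seq bool; core : seq bool; scale : nat }.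

Definition expo st :=
  exponent (radix (stage st)) (2 * size_ratio (stage st) * scale st) (phase st).

Definition start K u w :=
  State K 0 u w (radix K ^ stage_length K * size w).

Definition next_state st :=
  let run := wpow (fill st) (expo st) in
  let w := core st ++ run ++ core st in
  if (phase st).+1 < stage_length (stage st)
  then State (stage st) (phase st).+1 (fill st) w (scale st)
  else start (stage st).+1 (run ++ core st ++ run) w.

Definition state_at i := iter i next_state (start 0 [:: false] [:: true]).

Definition state_ok st :=
  [/\ 0 < size (fill st), 0 < size (core st),
      size (core st) <= expo st * size (fill st),
      phase st < stage_length (stage st) &
      radix (stage st) ^ stage_length (stage st) <= scale st].

Lemma start_ok K u w : 0 < size u -> 0 < size w -> state_ok (start K u w).
Proof.
move=> u_gt0 w_gt0; split=> //=; last by rewrite leq_pmulr.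
rewrite /expo /exponent /= mul1n expn0.
have q_gt0 : 0 < radix K ^ stage_length K.
  by rewrite expn_gt0 (ltn_trans _ (radix_gt2 K)).
apply: leq_trans (leq_pmulr _ u_gt0); rewrite -addn1 in q_gt0 *.
apply: leq_trans (leq_addr _ _); rewrite mulnA leq_pmull // !muln_gt0.
by rewrite /size_ratio.
Qed.

Lemma next_state_ok st : state_ok st -> state_ok (next_state st).
Proof.
case=> u_gt0 w_gt0 le_w lt_ph le_sc.
have w'_gt0 : 0 < size (core st ++ wpow (fill st) (expo st) ++ core st).
  by rewrite size_cat ltn_addr.
rewrite /next_state; case: ifP => lt_ph'; last first.
  by apply: start_ok => //; rewrite !size_cat; lia.
split=> //=; rewrite (size_cat (core st)) (size_cat (wpow _ _)) size_wpow.
apply: leq_trans (leq_mul (exponent_step _ _ (radix_gt2 _)) (leqnn _)).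
by rewrite -[exponent _ _ _]/(expo st); lia.
Qed.

Lemma state_atS i : state_at i.+1 = next_state (state_at i).
Proof. by []. Qed.

Lemma state_at_ok i : state_ok (state_at i).
Proof. by elim: i => [|i IHi]; [exact: start_ok | exact: next_state_ok]. Qed.

Lemma stage_run i : phase (state_at i) = 0 -> forall j,
  j < stage_length (stage (state_at i)) ->
  let st := state_at (i + j) in
  [/\ stage st = stage (state_at i), phase st = j,
      fill st = fill (state_at i) & scale st = scale (state_at i)].
Proof.
move=> ph0; elim=> [|j IHj] lt_j; first by rewrite addn0.
have [st_j ph_j fill_j sc_j] := IHj (ltnW lt_j).
by rewrite addnS state_atS /next_state ph_j st_j lt_j.
Qed.

Lemma stage_end i : phase (state_at i) = 0 ->
  let K := stage (state_at i) in
  let st := state_at (i + nb_pieces K) in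
  state_at (i + stage_length K) =
  start K.+1 (wpow (fill st) (expo st) ++ core st ++ wpow (fill st) (expo st))
    (core st ++ wpow (fill st) (expo st) ++ core st).
Proof.
move=> ph0 K st; rewrite /stage_length addnS state_atS -/st /next_state.
have [|st_j ph_j _ _] := stage_run ph0 (j := nb_pieces K); first exact: ltnSn.
by rewrite -/st in st_j ph_j; rewrite st_j ph_j ltnn.
Qed.

Lemma stage_reached K : exists i,
  [/\ K <= i, stage (state_at i) = K & phase (state_at i) = 0].
Proof.
elim: K => [|K [i [le_Ki st_i ph_i]]]; first by exists 0.
have := stage_end ph_i; rewrite /= st_i => E.
exists (i + stage_length K); rewrite E; split=> //.
by apply: leq_ltn_trans le_Ki _; rewrite -[X in X < _]addn0 ltn_add2l.
Qed.

Lemma wide_tu_step i : (fill (state_at i.+1) = fill (state_at i) /\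
    expo (state_at i) <= expo (state_at i.+1)) \/
  fill (state_at i.+1) = wpow (fill (state_at i)) (expo (state_at i)) ++
    core (state_at i) ++ wpow (fill (state_at i)) (expo (state_at i)).
Proof.
rewrite state_atS /next_state; case: ifP => _; [left | by right].
split=> //; apply: leq_trans (exponent_step _ _ (radix_gt2 _)).
by rewrite leq_pmull.
Qed.

Lemma wide_tw_step i : core (state_at i.+1) = core (state_at i) ++
  wpow (fill (state_at i)) (expo (state_at i)) ++ core (state_at i).
Proof. by rewrite state_atS /next_state; case: ifP. Qed.

Lemma wide_tu_change i : exists2 j, i <= j &
  fill (state_at j.+1) = wpow (fill (state_at j)) (expo (state_at j)) ++
    core (state_at j) ++ wpow (fill (state_at j)) (expo (state_at j)).
Proof.
have [k [le_ik _ ph_k]] := stage_reached i.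
exists (k + nb_pieces (stage (state_at k))).
  by rewrite (leq_trans le_ik) ?leq_addr.
by rewrite -addnS stage_end.
Qed.

Definition wide_tower : tower :=
  @Tower (fun i => fill (state_at i)) (fun i => core (state_at i))
    (fun i => expo (state_at i)) erefl erefl wide_tw_step wide_tu_step
    (fun i => let: And5 _ _ h _ _ := state_at_ok i in h) wide_tu_change.

(** A stage provides what [no_bounded_sadic] requires for the bound [K]. *)
Lemma wide_tower_stage K : exists i M,
  radix K ^ stage_length K <= M /\
  forall j, j < stage_length K -> tu wide_tower (i + j) = tu wide_tower i /\
    tm wide_tower (i + j) = exponent (radix K) (2 * size_ratio K * M) j.
Proof.
have [i [_ st_i ph_i]] := stage_reached K.
have [_ _ _ _] := state_at_ok i; rewrite st_i => le_M.
exists i, (scale (state_at i)); split=> // j lt_j.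
have [|st_j ph_j fill_j sc_j] := stage_run ph_i (j := j); first by rewrite st_i.
by rewrite /= /expo st_j ph_j fill_j sc_j st_i.
Qed.

(** * No bounded S-adic sequence generates the subshift *)

(** Brings the words of the tower into an alphabet [C] in which they can be
    compared with those of [s]. *)
Lemma generates_factor s t : generates s (tower_shift t) ->
  exists (C : finType) (f : letters s 0 -> C) (g : bool -> C),
    injective g /\ forall j, exists N (a : letters s N),
      infix (map g (tw t j)) (map f (subst_upto a)).
Proof.
move=> [C [f [g [_ g_inj E]]]]; exists C, f, g; split=> // j.
have [y Xy] := tower_shift_nonempty t.
have [k _ yk] := tower_shift_visits 0%R j Xy.
have : [set g \o y' | y' in tower_shift t]%classic (g \o y) by exists y.
rewrite -E => -[x Xx fx].
have [N [a xa]] := sadic_window k (size (tw t j)) Xx; exists N, a.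
by rewrite -yk -window_comp -fx window_comp map_infix.
Qed.

Lemma run_infix t i (C : eqType) (g : bool -> C) :
  infix (g true :: wpow (map g (tu t i)) (tm t i) ++ [:: g true]) (map g (tw t i.+1)).
Proof.
rewrite -map_wpow -/(map g [:: true]) -map_cat -/(map g (true :: _)); apply: map_infix.
have [x Ex] := last_tw t i; have [y Ey] := head_tw t i.
apply/infixP; exists x, y; rewrite tw_step {1}Ex Ey -cats1 -catA /=.
by rewrite -(catA (wpow _ _)).
Qed.

(** Take the level of the S-adic sequence with blocks of length about
    [M * size (tu t i)].  All runs of the stage are sums of at most [Q] pieces out
    of [K + (K * K + K * K)] for the blocks and their pairs, and there are not
    enough such sums for all combinations of the exponents. *)
Lemma no_bounded_sadic t i K r q D Q M s :
  K.+1 * K.+1 <= D -> 2 * D * (3 ^ r).+1 + 2 <= Q ->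
  (forall k, k <= K + (K * K + K * K) -> (r * q * Q).+1 ^ k < q ^ r) ->
  0 < q -> q ^ r <= M -> 1 < M ->
  (forall j, j < r -> tu t (i + j) = tu t i /\
    tm t (i + j) = exponent q (2 * D * M) j) ->
  generates s (tower_shift t) ->
  (forall n (a b : letters s n), size (subst_upto a) <= K.+1 * size (subst_upto b)) ->
  (forall n (a : letters s n.+1), size (subst a) <= K.+1) ->
  ~ (forall n, 1 <= n -> #|letters s n| <= K).
Proof.
move=> le_D le_Q few q_gt0 le_M M_gt1 stg gen bal bnd le_K.
have D_gt0 : 0 < D by apply: leq_trans le_D.
have [C [f [g [g_inj occurs]]]] := generates_factor gen.
pose p := size (tu t i); pose L := M * p.
have p_gt0 : 0 < p by apply: tu_gt0.
have L_gt1 : 1 < L by apply: leq_trans (leq_pmulr M p_gt0).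
have unb m : exists n (a : letters s n), m <= size (subst_upto a).
  have [N [a /size_infix]] := occurs m; rewrite !size_map => le_a; exists N, a.
  by apply: leq_trans le_a; apply/ltnW/tw_size.
have [n [n_gt0 sz_n blocks]] := level_of_size bal bnd L_gt1 unb.
pose blk (b : letters s n) := map f (subst_upto b); pose u := map g (tu t i).
have sz_u : size u = p by rewrite size_map.
have long j : 2 * D * L <= exponent q (2 * D * M) j * p.
  by rewrite /L mulnA leq_mul ?exponent_ge.
have short j : j < r -> exponent q (2 * D * M) j * p + 2 * L <= Q * L.
  move=> lt_jr; apply: leq_trans (leq_mul le_Q (leqnn L)).
  rewrite mulnDl leq_add2r /L mulnA leq_mul2r.
  by rewrite exponent_le ?orbT ?muln_gt0 // ltnW.
have pieces (j : 'I_r) : exists xs : seq (piece (letters s n)),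
    exponent q (2 * D * M) j * p = \sum_(x <- xs) piece_size blk u (g true) x /\
    size xs <= Q.
  have [tu_j tm_j] := stg j (ltn_ord j).
  have [N [a wa]] := occurs (i + j).+1.
  have := infix_trans (run_infix t (i + j) g) wa; rewrite tu_j tm_j => run.
  have [|bs Ea] := blocks N a.
    have := size_infix run.
    rewrite -[size (g true :: _)]/(size _).+1 (size_cat (wpow _ _)) size_wpow !size_map.
    move=> le1; apply: leq_trans le1; rewrite ltnS -/p.
    apply: leq_trans (leq_addr _ _); apply: leq_trans (long j).
    apply: leq_mul => //; apply: (leq_trans (leq_pmull _ (ltn0Sn K))).
    by apply: leq_trans le_D _; rewrite leq_pmull.
  rewrite Ea map_flatten -map_comp in run.
  have [|||||||xs sum_xs le_xs] := @run_pieces _ _ blk u (g true) L D _ _ _ _ _ _ _ bs _ run.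
  - by move=> b; rewrite size_map; case/andP: (sz_n b).
  - move=> b; rewrite size_map; have /andP[_ le_b] := sz_n b.
    by apply: leq_trans le_b _; apply: leq_mul.
  - by rewrite sz_u.
  - by rewrite sz_u leq_pmull // ltnW.
  - have [y Ey] := head_tu t i; rewrite /u Ey /=.
    by apply/eqP => /g_inj.
  - have [y Ey] := last_tu t i; rewrite /u Ey map_rcons last_rcons.
    by apply/eqP => /g_inj.
  - by rewrite sz_u.
  exists xs; split; first by rewrite -sum_xs sz_u.
  rewrite -(leq_pmul2r (ltnW L_gt1)); apply: leq_trans le_xs _.
  by rewrite sz_u short.
have /choice[xs xs_def] := pieces.
have := @count_values _ (piece_size blk u (g true)) r q Q xs
  (fun j : 'I_r => exponent q (2 * D * M) j * p).
rewrite leqNgt few; last first.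
  rewrite !(card_sum, card_prod).
  by have le := le_K n n_gt0; rewrite !leq_add // leq_mul.
suff key : forall f g : {ffun 'I_r -> 'I_q},
    \sum_(j < r) f j * (exponent q (2 * D * M) j * p) =
    \sum_(j < r) g j * (exponent q (2 * D * M) j * p) -> f = g.
  by move=> /(_ (fun j => (xs_def j).2) (fun j => (xs_def j).1) key).
move=> c1 c2 E; apply: (@exponent_inj q r (2 * D * M)).
  by apply: leq_trans le_M _; rewrite leq_pmull ?muln_gt0.
apply/eqP; rewrite -(eqn_pmul2r p_gt0) !big_distrl /=; apply/eqP.
by under eq_bigr do rewrite -mulnA; rewrite E; apply: eq_bigr => j _; rewrite mulnA.
Qed.

Lemma sup_alphabets_fin (R : realType) (s : sadic) :
  @sup_alphabets R s <> +oo%E ->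
  exists K : nat, forall n, 1 <= n -> #|letters s n| <= K.
Proof.
move=> sup_fin; have ub n : 1 <= n -> ((#|letters s n|%:R)%:E <= @sup_alphabets R s)%E.
  by move=> n_gt0; apply: ereal_sup_ubound; exists n.
move: ub sup_fin; case: sup_alphabets => [x ub _|//|ub _]; last by have := ub 1 isT.
exists (Num.truncn x) => n /ub; rewrite lee_fin => le_x.
by rewrite truncn_ge_nat // (le_trans (ler0n _ _) le_x).
Qed.

Local Open Scope classical_set_scope.
Local Open Scope ring_scope.

Theorem theorem8 (R : realType) :
  exists (A : finType) (X : set (int -> A)),
    [/\ (0 < #|A|)%N,
        minimal_subshift X,
        @linear_complexity R A X &
        forall s : sadic, generates s X ->
          (exists d : R, [/\ 1 <= d, P1 s d, P2 s d & P3 s d]) ->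
          sup_alphabets s = +oo%E :> \bar R].
Proof.
exists bool, (tower_shift wide_tower); split.
- by rewrite card_bool.
- exact: tower_shift_minimal.
- exact: tower_shift_linear.
move=> s gen [d [d_ge1 _ balanced bounded]].
apply/eqP/negPn/negP => /eqP /sup_alphabets_fin [K0 le_K0].
pose K := maxn K0 (Num.truncn d).
have le_d : d <= K.+1%:R.
  by apply: le_trans (ltW (truncnS_gt d)) _; rewrite ler_nat ltnS leq_maxr.
have [i [M [le_M stg]]] := wide_tower_stage K.
have q_gt2 := radix_gt2 K.
have q_gt0 : (0 < radix K)%N by apply: leq_trans q_gt2.
apply: (no_bounded_sadic (K := K) (leqnn _) (leqnn _) (@radix_big K) q_gt0 le_M _ stg gen).
- apply: leq_trans le_M; rewrite /stage_length expnS.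
  by apply: leq_trans (ltnW q_gt2) (leq_pmulr _ _); rewrite expn_gt0 q_gt0.
- move=> n a b; rewrite -(ler_nat R) natrM.
  by apply: le_trans (balanced n a b) _; rewrite ler_wpM2r.
- by move=> n a; rewrite -(ler_nat R); apply: le_trans (bounded n a) _.
- by move=> n n_gt0; rewrite leq_max le_K0.
Qed.
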